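(* For each positive integer $m$, there is a constant $C_m$ (depending only on $m$) such that $$\beta_{2m}(\mathbb{Z}_2^d) \;\leq\; C_m\, 2^{d/m} + O(1) \quad\text{as } d\to\infty .$$
   Context: $\mathbb{Z}_2^d$ is the additive group of $d$-dimensional vectors over $\mathbb{Z}_2$. For a finite abelian group $G$, a set $A\subseteq G$ is a zero-free set of rank $r$ if the sum of any $r$ distinct elements of $A$ is non-zero. When $r$ is a multiple of the exponent $\exp(G)$, $\beta_r(G)$ denotes the largest size of a zero-free set of rank $r$ in $G$. Here $m$ is fixed, and the implied constant in $O(1)$ may depend on $m$ but not on $d$. *)

(* Defs.v *)
From HB Require Import structures.
From mathcomp Require Import all_boot all_order all_algebra.

Set Implicit Arguments.
Unset Strict Implicit.
Unset Printing Implicit Defensive.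

Import GRing.Theory.
Local Open Scope ring_scope.

Definition zero_free (G : finZmodType) (r : nat) (A : {set G}) : bool :=
  [forall B : {set G},
    (B \subset A) && (#|B| == r) ==> (\sum_(x in B) x != 0)].

(* The usual proviso that [r] be a multiple of the exponent of [G] is not built
   in: [G] is finite and [set0] is zero-free for [0 < r], so the maximum is
   attained for every such [r]. *)
Definition beta (r : nat) (G : finZmodType) : nat :=
  \max_(A : {set G} | zero_free r A) #|A|.

(* Main.v *)
Require Import Defs.
From HB Require Import structures.
From mathcomp Require Import all_boot all_order all_algebra.
From mathcomp Require Import all_classical all_reals all_analysis.

Set Implicit Arguments.
Unset Strict Implicit.
Unset Printing Implicit Defensive.

Import Order.TTheory GRing.Theory Num.Theory numFieldNormedType.Exports.
Local Open Scope classical_set_scope.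
Local Open Scope ring_scope.

(** Following Ruzsa, let [n = #|A|] and let [T j s] (below, [reps j s]) be the
    number of words of length [j] over [A] whose letters add up to [s]. If [A]
    is zero-free of rank [2m], a word of length [2m] and sum [0] must repeat a
    letter; in a group of exponent 2 the two equal letters cancel, and deleting
    them leaves a word of length [2m - 2] and sum [0]. Counting the positions
    and the value of the repeated letter gives
    [T (2m) 0 <= c n T (2m - 2) 0] with [c = 'C(2m, 2)]
    (lemma [reps_nonuniq_le]).

    On the other hand the sequence [k |-> T (2k) 0] is log-convex: splitting a
    word in two makes [T (j + k) 0] the scalar product of [T j] and [T k]
    (lemma [reps_add0]), so this is the Cauchy-Schwarz inequality. The ratios of
    consecutive terms therefore increase; the last one is at most [c n], hence
    all are, and [T (2m) 0 <= (c n) ^ m]. Cauchy-Schwarz also gives the lower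
    bound [n ^ (2m) <= #|G| T (2m) 0], since the [n ^ m] words of length [m]
    have at most [#|G|] distinct sums. Comparing the two,
    [n ^ m <= c ^ m #|G|], and for [#|G| = 2 ^ d] an [m]-th root yields
    [n <= c 2 ^ (d / m)], valid for every [d]. *)

(** * Inequalities in the natural numbers *)

Lemma cauchy_schwarz_nat (I : finType) (f g : I -> nat) :
  ((\sum_i f i * g i) ^ 2 <= (\sum_i f i ^ 2) * (\sum_i g i ^ 2))%N.
Proof.
rewrite -mulnn !big_distrlr /= -(leq_pmul2l (ltn0Sn 1)).
(* Symmetrise the right-hand side in (i, j), then use 2ab <= a^2 + b^2. *)
rewrite [leqRHS]mul2n -addnn [X in (_ <= _ + X)%N]exchange_big /=.
rewrite -big_split /= big_distrr /=.
apply: leq_sum => i _; rewrite -big_split /= big_distrr /=; apply: leq_sum => j _.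
have := nat_Cauchy (f i * g j)%N (f j * g i)%N.
rewrite !expnMn => /(leq_trans _); apply.
by rewrite leq_mul2l /= mulnACA (mulnC (g i)) mulnACA.
Qed.

(** Log-convexity says that the ratios [u k.+1 / u k] increase, so a bound on
    the last ratio bounds them all. *)
Lemma log_convex_le_exp (u : nat -> nat) (c m : nat) :
  u 0 = 1%N -> (forall k, (u k.+1 ^ 2 <= u k * u k.+2)%N) ->
  (u m.+1 <= c * u m)%N -> (u m.+1 <= c ^ m.+1)%N.
Proof.
move=> u0 ucvx; elim: m => [|m IHm] um; first by rewrite u0 muln1 expn1 in um *.
have um' : (u m.+1 <= c * u m)%N.
  have [->//|um0] := posnP (u m.+1).
  rewrite -(leq_pmul2l um0) mulnn (leq_trans (ucvx m)) //.
  by rewrite mulnCA (mulnC (u m.+1)) mulnCA leq_mul2l um orbT.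
by rewrite (leq_trans um) // expnS leq_mul2l IHm ?orbT.
Qed.

(** * Words over a set and their sums *)

Section Words.
Variables (G : finZmodType) (A : {set G}).
Implicit Types (P : pred (seq G)) (w : seq G) (s a x : G).

Fixpoint words j : seq (seq G) :=
  if j is j'.+1 then [seq a :: w | a <- enum A, w <- words j'] else [:: [::]].

Definition wsum w : G := \sum_(x <- w) x.

Definition reps j s : nat := count (fun w => wsum w == s) (words j).
Arguments reps j%_N s%_R.

Lemma wsum_cons a w s : (wsum (a :: w) == s) = (wsum w == s - a).
Proof. by rewrite /wsum big_cons addrC eq_sym -subr_eq eq_sym. Qed.

Lemma mem_words j w : w \in words j -> size w = j /\ {subset w <= A}.
Proof.
elim: j w => [|j IHj] w /=; first by rewrite inE => /eqP->.
case/allpairsP => -[a v] /= [aA /IHj[sv vA] ->] /=; split; first by rewrite sv.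
by move=> x; rewrite inE => /predU1P[->|/vA//]; rewrite mem_enum in aA.
Qed.

Lemma count_wordsS P j :
  count P (words j.+1) = (\sum_(a in A) count (fun w => P (a :: w)) (words j))%N.
Proof.
rewrite /= count_flatten -map_comp sumnE big_map big_enum /=.
by apply: eq_bigr => a _; rewrite count_map.
Qed.

Lemma reps0 s : reps 0 s = (s == 0).
Proof. by rewrite /reps /= /wsum big_nil addn0 eq_sym. Qed.

Lemma repsS j s : reps j.+1 s = (\sum_(a in A) reps j (s - a))%N.
Proof.
rewrite /reps count_wordsS; apply: eq_bigr => a _.
by apply: eq_count => w; rewrite wsum_cons.
Qed.

Lemma sum_reps j : (\sum_s reps j s)%N = (#|A| ^ j)%N.
Proof.
elim: j => [|j IHj].
  by rewrite (bigD1 0) //= big1 => [|s /negPf s0]; rewrite reps0 ?eqxx ?s0.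
under eq_bigr do rewrite repsS.
rewrite exchange_big /= expnS -IHj -sum_nat_const.
by apply: eq_bigr => a _; rewrite [RHS](reindex_inj (@addIr _ (- a))).
Qed.

(** Deleting one occurrence of [a] from a word leaves a shorter word of sum
    [s - a]; the factor [j] counts the possible positions of that occurrence. *)
Lemma count_mem_le j s a :
  (count (fun w => (wsum w == s) && (a \in w)) (words j)
    <= j * reps j.-1 (s - a))%N.
Proof.
elim: j s => [|j IHj] s; first by rewrite /= in_nil andbF.
rewrite count_wordsS /= mulSn.
(* The first letter is [a], or the tail contains [a]. *)
have split_head b : (count (fun w => (wsum (b :: w) == s) && (a \in b :: w))
    (words j) <= (b == a) * reps j (s - a) + j * reps j.-1 (s - b - a))%N.
  apply: leq_trans (leq_add (leqnn _) (IHj _)).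
  have [->|ba] := eqVneq b a.
    rewrite mul1n (leq_trans _ (leq_addr _ _)) // sub_count // => w /=.
    by rewrite wsum_cons => /andP[].
  rewrite add0n sub_count // => w /=.
  by rewrite wsum_cons inE (eq_sym a) (negPf ba).
apply: leq_trans (leq_sum _ (fun b _ => split_head b)) _.
rewrite big_split /= leq_add //.
  rewrite -big_distrl /= -[leqRHS]mul1n leq_mul2r; apply/orP; right.
  rewrite big_mkcond /= (bigD1 a) //= eqxx big1 => [|b /negPf->]; last exact: if_same.
  by rewrite addn0; case: ifP.
(* For [j = 0] the predecessor is truncated and the factor [j] vanishes. *)
case: j {IHj split_head} => [|j]; first by rewrite big1.
by rewrite -big_distrr repsS leq_mul2l leq_sum // => b _; rewrite addrAC.
Qed.

Hypothesis expG2 : forall x : G, x + x = 0.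

(** A word with a repeated letter is determined by the two positions of that
    letter, its value, and the remaining word, which has the same sum because
    the two equal letters cancel. *)
Lemma reps_nonuniq_le j s :
  (count (fun w => (wsum w == s) && ~~ uniq w) (words j)
    <= 'C(j, 2) * (#|A| * reps j.-2 s))%N.
Proof.
elim: j s => [|j IHj] s; first by rewrite /= andbF.
rewrite count_wordsS /= binS bin1 addnC mulnDl.
(* The first letter recurs in the tail, or the tail itself has a repetition. In
   the first case deleting the second copy leaves sum [s - a - a = s]. *)
have split_head a : (count (fun w => (wsum (a :: w) == s) && ~~ uniq (a :: w))
    (words j) <= j * reps j.-1 s + 'C(j, 2) * (#|A| * reps j.-2 (s - a)))%N.
  have := count_mem_le j (s - a) a.
  rewrite -addrA -opprD expG2 subr0 => memle.
  apply: leq_trans (leq_add memle (IHj _)).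
  rewrite -count_predUI; apply: leq_trans (leq_addr _ _).
  by apply: sub_count => w; rewrite /= wsum_cons negb_and negbK andb_orr.
apply: leq_trans (leq_sum _ (fun a _ => split_head a)) _.
rewrite big_split /= sum_nat_const leq_add //; first by rewrite mulnCA.
(* For [j <= 1], where [j.-2] is truncated, ['C(j, 2) = 0]. *)
case: j {IHj split_head} => [|[|j]]; [by rewrite big1|by rewrite big1|].
by rewrite -!big_distrr repsS.
Qed.

Lemma reps_add0 j k : reps (j + k) 0 = (\sum_t reps j t * reps k t)%N.
Proof.
have oppG (x : G) : - x = x by apply/esym/eqP; rewrite -addr_eq0 expG2.
have conv s : reps (j + k) s = (\sum_t reps j t * reps k (s - t))%N.
  elim: j s => [|j IHj] s.
    rewrite (bigD1 0) //= big1 => [|t /negPf t0]; rewrite reps0 ?t0 //.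
    by rewrite eqxx mul1n addn0 subr0.
  rewrite addSn repsS; under [RHS]eq_bigr do rewrite repsS big_distrl.
  rewrite [RHS]exchange_big /=; apply: eq_bigr => a _.
  (* Move the first letter [a] out of the sum [t] of the left-hand word. *)
  rewrite IHj [RHS](reindex_inj (@addIr _ a)) /=; apply: eq_bigr => t _.
  by rewrite addrK opprD addrA addrAC.
by rewrite conv; apply: eq_bigr => t _; rewrite sub0r oppG.
Qed.

(** Cauchy-Schwarz for the splitting [2 (k + 1) = k + (k + 2)]. *)
Lemma reps_double_log_convex k :
  (reps k.+1.*2 0 ^ 2 <= reps k.*2 0 * reps k.+2.*2 0)%N.
Proof.
by rewrite -!addnn addSnnS !reps_add0 (leq_trans (cauchy_schwarz_nat _ _)) //.
Qed.

(** Cauchy-Schwarz against the constant function [1]. *)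
Lemma reps_double_ge k : ((#|A| ^ k) ^ 2 <= #|G| * reps k.*2 0)%N.
Proof.
rewrite -sum_reps.
have := cauchy_schwarz_nat (fun=> 1%N) (reps k).
under eq_bigr do rewrite mul1n.
rewrite sum_nat_const muln1 => /leq_trans; apply.
by rewrite leq_mul2l -addnn reps_add0 (eq_bigr _ (fun t _ => mulnn _)) leqnn orbT.
Qed.

Lemma zero_free_nonuniq r w :
  zero_free r A -> w \in words r -> wsum w = 0 -> ~~ uniq w.
Proof.
move=> /forallP/(_ [set x in w]) zfA /mem_words[sw wA] w0; apply/negP => uw.
move: zfA; rewrite cardsE (card_uniqP uw) sw eqxx andbT.
have -> : [set x in w] \subset A by apply/fintype.subsetP => x; rewrite inE => /wA.
rewrite (eq_bigl (mem w)) => [|x]; last by rewrite inE.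
by rewrite -big_uniq //= -/(wsum w) w0 eqxx.
Qed.

Lemma zero_free_card_le m : (0 < m)%N -> zero_free (2 * m) A ->
  (#|A| ^ m <= 'C(2 * m, 2) ^ m * #|G|)%N.
Proof.
case: m => // m _; rewrite mul2n => zfA; set c := 'C(_, 2).
have [->|n_gt0] := posnP #|A|; first by rewrite exp0n.
have ratio : (reps m.+1.*2 0 <= c * #|A| * reps m.*2 0)%N.
  rewrite -mulnA (leq_trans _ (reps_nonuniq_le _ _)) // /reps.
  rewrite (@eq_in_count _ _ (fun w => (wsum w == 0) && ~~ uniq w)) // => w wA /=.
  by have [w0|//] := eqVneq; rewrite (zero_free_nonuniq zfA wA w0).
have energy_le : (reps m.+1.*2 0 <= (c * #|A|) ^ m.+1)%N.
  apply: (@log_convex_le_exp (fun k => reps k.*2 0)) ratio.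
    by rewrite reps0 eqxx.
  exact: reps_double_log_convex.
(* Both bounds now read [n ^ (2m) <= #|G| (c n) ^ m]; cancel [n ^ m]. *)
rewrite -(@leq_pmul2l (#|A| ^ m.+1)) ?expn_gt0 ?n_gt0 // mulnn.
rewrite (leq_trans (reps_double_ge _)) //.
by rewrite mulnA -expnMn (mulnC #|A|) mulnC leq_mul2r energy_le orbT.
Qed.

End Words.

(** * The bound in elementary abelian 2-groups *)

Lemma beta_le (R : realType) (m d : nat) : (0 < m)%N ->
  (beta (2 * m) 'rV['Z_2]_d)%:R <= 'C(2 * m, 2)%:R * 2 `^ (d%:R / m%:R) :> R.
Proof.
move=> m0; rewrite -(ler_pXn2r m0) ?nnegrE ?mulr_ge0 ?powR_ge0 //.
have -> : ('C(2 * m, 2)%:R * 2 `^ (d%:R / m%:R)) ^+ m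
    = ('C(2 * m, 2) ^ m * 2 ^ d)%:R :> R.
  rewrite exprMn -[X in _ * X]powR_mulrn ?powR_ge0 // -powRrM divfK ?pnatr_eq0 -?lt0n //.
  by rewrite powR_mulrn // natrM !natrX.
rewrite -natrX ler_nat.
have expG2 (x : 'rV['Z_2]_d) : x + x = 0.
  by apply/rowP => i; rewrite !mxE; apply/val_inj; case: (x 0 i) => [[|[|[]]]].
rewrite /beta; elim/big_ind: _ => [|a b ha hb|A zfA]; first by rewrite exp0n.
  by rewrite /maxn; case: ifP.
by have := zero_free_card_le expG2 m0 zfA; rewrite card_mx card_ord mul1n.
Qed.

Theorem theorem4p4 (R : realType) (m : nat) (hm : (0 < m)%N) :
  exists (C : R) (E : nat -> R),
    E =O_\oo (fun _ : nat => 1 : R) /\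
    \forall d \near \oo,
      (beta (2 * m) 'rV['Z_2]_d)%:R <= C * 2 `^ (d%:R / m%:R) + E d.
Proof.
exists 'C(2 * m, 2)%:R, (fun=> 0); split.
  by apply/eqOP; exists 0; split => // k k0; near=> d; rewrite normr0 mulr_ge0 // ltW.
by near=> d; rewrite addr0 beta_le.
Unshelve. all: by end_near.
Qed.
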